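(* Let $Q_1Q_2\ldots Q_m P\rightarrow P$ be any generator. Then either $$Q_1Q_2\ldots Q_m P\rightarrow P\ \simeq\ \Box P\rightarrow P,$$ or there is an integer $k\ge 0$ such that $$Q_1Q_2\ldots Q_m P\rightarrow P\ \simeq\ \Box^k u{:}P\rightarrow P .$$ That is, any reflection principle is equivalent to either $\Box P\rightarrow P$ or, for some $k\ge 0$, to $\Box^k u{:}P\rightarrow P$.
   Context: $\mathsf{PA}$ is Peano Arithmetic. A proof predicate is a provably decidable (i.e. $\mathsf{PA}$-provably $\Delta_1$) arithmetical formula $\mathrm{Proof}(x,y)$ that enumerates all theorems of $\mathsf{PA}$: $\mathsf{PA}\vdash\varphi$ iff $\mathrm{Proof}(k,\varphi)$ holds for some natural number $k$ (formulas are identified with their codes). It is normal if (1) for every $k$ the set $T(k)=\{\varphi\mid \mathrm{Proof}(k,\varphi)\}$ is finite and the function $k\mapsto T(k)$ is computable; (2) for any $k,l$ there is $n$ with $T(k)\cup T(l)\subseteq T(n)$. (Prime example: Gödel's proof predicate.) Fix a normal proof predicate $\mathrm{Proof}$ and let $\mathrm{Provable}(F)$ be $\exists x\,\mathrm{Proof}(x,F)$. It is assumed that $\mathrm{Provable}$ obeys the axioms of provability logic: for all arithmetical sentences $F,G$, writing $\Box$ for $\mathrm{Provable}$, $\mathsf{PA}$ proves $\Box(F\rightarrow G)\rightarrow(\Box F\rightarrow\Box G)$, $\Box F\rightarrow\Box\Box F$ and $\Box(\Box F\rightarrow F)\rightarrow\Box F$. Formulas here are built from propositional (sentence) letters by Boolean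 connectives, $\Box F$ (''$F$ is provable'') and $u{:}F$ (''$u$ is a proof of $F$''), with $u$ a proof variable. An arithmetical interpretation $\ast$ assigns an arithmetical sentence to each propositional letter and a natural number to each proof variable; it commutes with Boolean connectives, and $(\Box F)^\ast=\mathrm{Provable}(F^\ast)$, $(u{:}F)^\ast=\mathrm{Proof}(u^\ast,F^\ast)$. For a formula $F$, $\{F^\ast\}$ is the set of all its arithmetical interpretations. Let $P$ be a propositional letter and let each $Q_1,\ldots,Q_m$ ($m\ge1$) be either $\Box$ or ''$u{:}$'' for some fresh proof variable $u$ (so distinct occurrences use distinct proof variables). The formula $Q_1Q_2\ldots Q_mP\rightarrow P$ is called a generator, and the set of all its arithmetical interpretations is the corresponding reflection principle; reflection principles are referred to by their generators. $\Box^k$ denotes $k$ consecutive $\Box$'s. For formulas $G,H$: $H\preceq G$ means that $\mathsf{PA}+\{G^\ast\}$ proves all formulas in $\{H^\ast\}$; $H\simeq G$ (''$H$ is equivalent to $G$'') means $H\preceq G$ and $G\preceq H$. *)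

(* Defs.v *)
From mathcomp Require Import all_boot.
From Stdlib Require List.

Set Implicit Arguments.
Unset Strict Implicit.
Unset Printing Implicit Defensive.

(* Variables are de Bruijn indices: [tvar 0] refers to the innermost binder. *)
Inductive term : Type :=
| tvar of nat
| tzero
| tsucc of term
| tadd of term & term
| tmul of term & term.

Inductive form : Type :=
| feq of term & term
| fbot
| fimp of form & form
| fall of form.

(* The logic is classical, so the other connectives are abbreviations. *)
Definition fneg (f : form) : form := fimp f fbot.
Definition fand (f g : form) : form := fneg (fimp f (fneg g)).
Definition fiff (f g : form) : form := fand (fimp f g) (fimp g f).
Definition fex (f : form) : form := fneg (fall (fneg f)).

Fixpoint num (n : nat) : term := if n is m.+1 then tsucc (num m) else tzero.

Definition scons (X : Type) (x : X) (s : nat -> X) (n : nat) : X :=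
  if n is m.+1 then s m else x.

Fixpoint subst_term (s : nat -> term) (t : term) : term :=
  match t with
  | tvar n => s n
  | tzero => tzero
  | tsucc u => tsucc (subst_term s u)
  | tadd u v => tadd (subst_term s u) (subst_term s v)
  | tmul u v => tmul (subst_term s u) (subst_term s v)
  end.

Definition shift_term : term -> term := subst_term (fun n => tvar n.+1).

Definition up (s : nat -> term) : nat -> term :=
  scons (tvar 0) (fun n => shift_term (s n)).

Fixpoint subst (s : nat -> term) (f : form) : form :=
  match f with
  | feq t u => feq (subst_term s t) (subst_term s u)
  | fbot => fbot
  | fimp g h => fimp (subst s g) (subst s h)
  | fall g => fall (subst (up s) g)
  end.

Definition shift : form -> form := subst (fun n => tvar n.+1).

(* [inst t f] is the instance of [fall f] at [t]. *)
Definition inst (t : term) : form -> form := subst (scons t tvar).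

(* [form_lt n f] holds when all free variables of [f] are among 0, ..., n - 1. *)
Fixpoint term_lt (n : nat) (t : term) : bool :=
  match t with
  | tvar i => i < n
  | tzero => true
  | tsucc u => term_lt n u
  | tadd u v | tmul u v => term_lt n u && term_lt n v
  end.

Fixpoint form_lt (n : nat) (f : form) : bool :=
  match f with
  | feq t u => term_lt n t && term_lt n u
  | fbot => true
  | fimp g h => form_lt n g && form_lt n h
  | fall g => form_lt n.+1 g
  end.

Definition sentence (f : form) : bool := form_lt 0 f.

Fixpoint teval (r : nat -> nat) (t : term) : nat :=
  match t with
  | tvar n => r n
  | tzero => 0
  | tsucc u => (teval r u).+1
  | tadd u v => teval r u + teval r v
  | tmul u v => teval r u * teval r v
  end.

Fixpoint sat (r : nat -> nat) (f : form) : Prop :=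
  match f with
  | feq t u => teval r t = teval r u
  | fbot => False
  | fimp g h => sat r g -> sat r h
  | fall g => forall n : nat, sat (scons n r) g
  end.

Definition holds (f : form) : Prop := forall r : nat -> nat, sat r f.

(* Classical natural deduction with equality over a set [T] of axioms.  Free
   variables of members of [T] are read as universally quantified; those of
   the local hypotheses [G] are not, whence the shift in [prv_allI]. *)
Inductive prv (T : form -> Prop) : seq form -> form -> Prop :=
| prv_ax G f : T f -> prv T G f
| prv_hyp G f : List.In f G -> prv T G f
| prv_impI G f g : prv T (f :: G) g -> prv T G (fimp f g)
| prv_impE G f g : prv T G (fimp f g) -> prv T G f -> prv T G g
| prv_dne G f : prv T G (fneg (fneg f)) -> prv T G f
| prv_allI G f : prv T (map shift G) f -> prv T G (fall f)
| prv_allE G f t : prv T G (fall f) -> prv T G (inst t f)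
| prv_eq_refl G t : prv T G (feq t t)
| prv_eq_subst G f t u :
    prv T G (feq t u) -> prv T G (inst t f) -> prv T G (inst u f).

Definition proves (T : form -> Prop) (f : form) : Prop := prv T [::] f.

(* In [PA_induction] the formula [f] may have further free variables as
   parameters; the substitution in the induction step replaces the induction
   variable by its successor under the same binder. *)
Inductive PA : form -> Prop :=
| PA_succ_neq0 : PA (fneg (feq (tsucc (tvar 0)) tzero))
| PA_succ_inj :
    PA (fimp (feq (tsucc (tvar 0)) (tsucc (tvar 1))) (feq (tvar 0) (tvar 1)))
| PA_add0 : PA (feq (tadd (tvar 0) tzero) (tvar 0))
| PA_addS :
    PA (feq (tadd (tvar 0) (tsucc (tvar 1))) (tsucc (tadd (tvar 0) (tvar 1))))
| PA_mul0 : PA (feq (tmul (tvar 0) tzero) tzero)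
| PA_mulS :
    PA (feq (tmul (tvar 0) (tsucc (tvar 1)))
            (tadd (tmul (tvar 0) (tvar 1)) (tvar 0)))
| PA_induction f :
    PA (fimp (inst tzero f)
       (fimp (fall (fimp f (subst (scons (tsucc (tvar 0)) (fun n => tvar n.+1)) f)))
             (fall f))).

(* t < u, i.e. z + S t = u for some z *)
Definition flt (t u : term) : form :=
  fex (feq (tadd (tvar 0) (tsucc (shift_term t))) (shift_term u)).

Inductive delta0 : form -> Prop :=
| delta0_eq t u : delta0 (feq t u)
| delta0_bot : delta0 fbot
| delta0_imp f g : delta0 f -> delta0 g -> delta0 (fimp f g)
| delta0_all t f :
    delta0 f -> delta0 (fall (fimp (flt (tvar 0) (shift_term t)) f)).

Inductive sigma1 : form -> Prop :=
| sigma1_delta0 f : delta0 f -> sigma1 f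
| sigma1_ex f : sigma1 f -> sigma1 (fex f).

Inductive pi1 : form -> Prop :=
| pi1_delta0 f : delta0 f -> pi1 f
| pi1_all f : pi1 f -> pi1 (fall f).

Definition provably_delta1 (f : form) : Prop :=
  (exists2 g, sigma1 g & proves PA (fiff f g)) /\
  (exists2 h, pi1 h & proves PA (fiff f h)).

(* [CodeSeq.code] is a computable bijection from [seq nat] to [nat]; the first
   entry of each list is a tag for the head constructor. *)
Fixpoint tcode (t : term) : nat :=
  match t with
  | tvar n => CodeSeq.code [:: 0; n]
  | tzero => CodeSeq.code [:: 1]
  | tsucc u => CodeSeq.code [:: 2; tcode u]
  | tadd u v => CodeSeq.code [:: 3; tcode u; tcode v]
  | tmul u v => CodeSeq.code [:: 4; tcode u; tcode v]
  end.

Fixpoint code (f : form) : nat :=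
  match f with
  | feq t u => CodeSeq.code [:: 0; tcode t; tcode u]
  | fbot => CodeSeq.code [:: 1]
  | fimp g h => CodeSeq.code [:: 2; code g; code h]
  | fall g => CodeSeq.code [:: 3; code g]
  end.

Lemma tcode_inj : injective tcode.
Proof.
elim=> [n||t IHt|t IHt u IHu|t IHt u IHu] [m||t'|t' u'|t' u'] // eqc;
  have := can_inj CodeSeq.codeK eqc => //; case.
- by move->.
- by move/IHt->.
- by move=> /IHt-> /IHu->.
- by move=> /IHt-> /IHu->.
Qed.

Lemma code_inj : injective code.
Proof.
elim=> [t u||f IHf g IHg|f IHf] [t' u'||f' g'|f'] // eqc;
  have := can_inj CodeSeq.codeK eqc => //; case.
- by move=> /tcode_inj-> /tcode_inj->.
- by move=> /IHf-> /IHg->.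
- by move/IHf->.
Qed.

(* The total recursive functions: minimization is applied to regular
   functions only, so that no partial functions are needed. *)
Inductive recursive : forall n : nat, (n.-tuple nat -> nat) -> Prop :=
| rec_zero n : recursive (fun _ : n.-tuple nat => 0)
| rec_succ : recursive (fun v : 1.-tuple nat => (thead v).+1)
| rec_proj n (i : 'I_n) : recursive (fun v : n.-tuple nat => tnth v i)
| rec_comp m n (f : m.-tuple nat -> nat) (g : 'I_m -> n.-tuple nat -> nat) :
    recursive f -> (forall i, recursive (g i)) ->
    recursive (fun v : n.-tuple nat => f [tuple g i v | i < m])
| rec_prim n (f : n.-tuple nat -> nat) (g : n.+2.-tuple nat -> nat)
    (h : n.+1.-tuple nat -> nat) :
    recursive f -> recursive g ->
    (forall v : n.-tuple nat, h (cons_tuple 0 v) = f v) ->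
    (forall (i : nat) (v : n.-tuple nat),
        h (cons_tuple i.+1 v) =
        g (cons_tuple i (cons_tuple (h (cons_tuple i v)) v))) ->
    recursive h
| rec_mu n (f : n.+1.-tuple nat -> nat) (h : n.-tuple nat -> nat) :
    recursive f ->
    (forall v : n.-tuple nat, f (cons_tuple (h v) v) = 0) ->
    (forall (v : n.-tuple nat) (i : nat), i < h v -> f (cons_tuple i v) <> 0) ->
    recursive h.

Definition computable (f : nat -> nat) : Prop :=
  exists2 h : 1.-tuple nat -> nat, recursive h & forall n, f n = h [tuple n].

(* Membership in the finite set with canonical index [e], i.e. the set of
   positions of the digit 1 in the binary expansion of [e]. *)
Definition in_fin (e n : nat) : bool := odd (e %/ 2 ^ n).

(* An arithmetical formula Proof(x, y) is a [form] in which variable 0 plays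
   the role of x and variable 1 that of y. *)
Definition apply2 (Prf : form) (s t : term) : form :=
  subst (scons s (fun=> t)) Prf.

Definition proof_of (Prf : form) (k : nat) (f : form) : form :=
  apply2 Prf (num k) (num (code f)).

Definition provable (Prf : form) (f : form) : form :=
  fex (apply2 Prf (tvar 0) (num (code f))).

Definition proof_predicate (Prf : form) : Prop :=
  [/\ form_lt 2 Prf,
      provably_delta1 Prf
    & forall f, sentence f ->
        (proves PA f <-> exists k, holds (proof_of Prf k f))].

(* [proved_by Prf k] is T(k), as a set of sentences. *)
Definition proved_by (Prf : form) (k : nat) (f : form) : Prop :=
  sentence f /\ holds (proof_of Prf k f).

(* The computability clause states that the canonical index of the set of codes
   of T(k) is a computable function of k. *)
Definition normal (Prf : form) : Prop :=
  [/\ forall k, exists s : seq form, forall f, proved_by Prf k f -> List.In f s,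
      exists2 e : nat -> nat, computable e &
        forall k n, in_fin (e k) n <-> exists2 f, proved_by Prf k f & code f = n
    & forall k l, exists n, forall f,
        proved_by Prf k f \/ proved_by Prf l f -> proved_by Prf n f].

Definition provability_logic (Prf : form) : Prop :=
  let box := provable Prf in
  [/\ forall f g, sentence f -> sentence g ->
        proves PA (fimp (box (fimp f g)) (fimp (box f) (box g))),
      forall f, sentence f -> proves PA (fimp (box f) (box (box f)))
    & forall f, sentence f ->
        proves PA (fimp (box (fimp (box f) f)) (box f))].

(* [Letter p]: propositional letter; [Box F]: F is provable;
   [Pr u F]: the proof variable u is a proof of F. *)
Inductive mform : Type :=
| Letter of nat
| Bot
| Imp of mform & mform
| Box of mform
| Pr of nat & mform.

Record interpretation : Type := Interpretation {
  letter : nat -> form;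
  letter_sentence : forall p, sentence (letter p);
  pvar : nat -> nat
}.

Fixpoint interp (Prf : form) (i : interpretation) (F : mform) : form :=
  match F with
  | Letter p => letter i p
  | Bot => fbot
  | Imp G H => fimp (interp Prf i G) (interp Prf i H)
  | Box G => provable Prf (interp Prf i G)
  | Pr u G => proof_of Prf (pvar i u) (interp Prf i G)
  end.

Definition interps (Prf : form) (F : mform) (f : form) : Prop :=
  exists i : interpretation, f = interp Prf i F.

(* [reducible Prf H G]: PA together with all arithmetical interpretations of G
   proves all arithmetical interpretations of H. *)
Definition reducible (Prf : form) (H G : mform) : Prop :=
  forall f, interps Prf H f -> proves (fun g => PA g \/ interps Prf G g) f.

Definition equivalent (Prf : form) (H G : mform) : Prop :=
  reducible Prf H G /\ reducible Prf G H.

Inductive modality : Type := QBox | QProof of nat.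

Definition modal (Q : modality) (F : mform) : mform :=
  if Q is QProof u then Pr u F else Box F.

Definition proof_vars (Qs : seq modality) : seq nat :=
  pmap (fun Q => if Q is QProof u then Some u else None) Qs.

Definition generator (Qs : seq modality) (P : nat) : mform :=
  Imp (foldr modal (Letter P) Qs) (Letter P).

(* Main.v *)
Require Import Defs.
From mathcomp Require Import all_boot.
From Stdlib Require Import Classical.

(** Up to provability in PA, a generator depends only on the length [k] of the
    block of boxes that precedes its first explicit proof "u:". Since [Prf] is
    provably Delta_1, a false instance of [u:R] is refutable in PA, so that
    [Box^k u:R -> P] becomes [Box^k bot -> P]; a true instance makes [R] a
    theorem, hence, by soundness of PA, also [P]. Each generator containing a
    "u:" is therefore equivalent to [~ Box^k bot]. In a generator without "u:"
    the boxes collapse to one by [Box P -> Box Box P] in one direction, and by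
    iterating reflection over [Box^j P] in the other. *)

(** * Substitution *)

Lemma eq_subst_term s s' t : s =1 s' -> subst_term s t = subst_term s' t.
Proof. by move=> ss'; elim: t => //= [t ->|t -> u ->|t -> u ->]. Qed.

Lemma eq_up s s' : s =1 s' -> up s =1 up s'.
Proof. by move=> ss' [|n] //=; rewrite ss'. Qed.

(** Substitutions are functions, so they are compared pointwise throughout instead of by functional
    extensionality. *)
Lemma eq_subst s s' f : s =1 s' -> subst s f = subst s' f.
Proof.
elim: f s s' => [t u||f IHf g IHg|f IHf] s s' ss' //=.
- by rewrite !(eq_subst_term _ _ _ ss').
- by rewrite (IHf _ _ ss') (IHg _ _ ss').
- by rewrite (IHf _ _ (eq_up _ _ ss')).
Qed.

Lemma subst_term_comp s s' t :
  subst_term s (subst_term s' t) = subst_term (fun n => subst_term s (s' n)) t.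
Proof. by elim: t => //= [t ->|t -> u ->|t -> u ->]. Qed.

Lemma subst_term_up s t :
  subst_term (up s) (shift_term t) = shift_term (subst_term s t).
Proof. by rewrite /shift_term !subst_term_comp; apply: eq_subst_term. Qed.

Lemma subst_comp s s' f :
  subst s (subst s' f) = subst (fun n => subst_term s (s' n)) f.
Proof.
elim: f s s' => [t u||f IHf g IHg|f IHf] s s' //=.
- by rewrite !subst_term_comp.
- by rewrite IHf IHg.
- rewrite IHf; congr fall; apply: eq_subst => -[|n] //=.
  exact: subst_term_up.
Qed.

Lemma subst_term_tvar t : subst_term tvar t = t.
Proof. by elim: t => //= [t ->|t -> u ->|t -> u ->]. Qed.

Lemma subst_tvar f : subst tvar f = f.
Proof.
elim: f => [t u||f IHf g IHg|f IHf] //=.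
- by rewrite !subst_term_tvar.
- by rewrite IHf IHg.
- by rewrite -[in RHS]IHf; congr fall; apply: eq_subst => -[].
Qed.

Lemma inst_subst s t f : inst t (subst (up s) f) = subst (scons t s) f.
Proof.
rewrite /inst subst_comp; apply: eq_subst => -[|n] //=.
by rewrite /shift_term subst_term_comp subst_term_tvar.
Qed.

Lemma subst_term_num s n : subst_term s (num n) = num n.
Proof. by elim: n => //= n ->. Qed.

Lemma subst_term_lt n s s' t :
  term_lt n t -> (forall i, i < n -> s i = s' i) ->
  subst_term s t = subst_term s' t.
Proof.
move=> + ss'; elim: t => [i /ss'||t IH /IH /= ->|t IHt u IHu|t IHt u IHu] //;
  by case/andP=> /IHt /= -> /IHu ->.
Qed.

Lemma subst_lt n s s' f :
  form_lt n f -> (forall i, i < n -> s i = s' i) -> subst s f = subst s' f.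
Proof.
elim: f n s s' => [t u||f IHf g IHg|f IHf] n s s' //=.
- by case/andP=> tn un ss'; rewrite !(@subst_term_lt n s s').
- by case/andP=> fn gn ss'; rewrite (IHf n s s') // (IHg n s s').
- move=> fn ss'; rewrite (IHf n.+1 (up s) (up s')) // => -[|i] //= lt_in.
  by rewrite ss'.
Qed.

Lemma term_lt_subst n m s t :
  term_lt n t -> (forall i, i < n -> term_lt m (s i)) ->
  term_lt m (subst_term s t).
Proof.
move=> + sm; elim: t => [i /sm||t IH /IH|t IHt u IHu|t IHt u IHu] //;
  by case/andP=> /IHt /= -> /IHu ->.
Qed.

Lemma form_lt_subst n m s f :
  form_lt n f -> (forall i, i < n -> term_lt m (s i)) ->
  form_lt m (subst s f).
Proof.
elim: f n m s => [t u||f IHf g IHg|f IHf] n m s //=.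
- by case/andP=> tn un sm; rewrite !(@term_lt_subst n).
- by case/andP=> fn gn sm; rewrite (IHf n) // (IHg n).
- move=> fn sm; apply: (IHf n.+1) => // -[|i] //= lt_in.
  exact: (@term_lt_subst m) (sm _ lt_in) _.
Qed.

Lemma term_lt_num m n : term_lt m (num n).
Proof. by elim: n. Qed.

Lemma term_ltW m n t : m <= n -> term_lt m t -> term_lt n t.
Proof.
move=> le_mn; elim: t => //= [i lt_im|t IHt u IHu|t IHt u IHu].
- exact: leq_trans le_mn.
- by case/andP=> /IHt-> /IHu->.
- by case/andP=> /IHt-> /IHu->.
Qed.

Lemma form_ltW m n f : m <= n -> form_lt m f -> form_lt n f.
Proof.
elim: f m n => [t u||f IHf g IHg|f IHf] m n le_mn //=.
- by case/andP=> /(term_ltW _ _ _ le_mn)-> /(term_ltW _ _ _ le_mn)->.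
- by case/andP=> /(IHf _ _ le_mn)-> /(IHg _ _ le_mn)->.
- exact: IHf.
Qed.

Lemma term_bounded t : exists n, term_lt n t.
Proof.
elim: t => [n||t [n tn]|t [n tn] u [m um]|t [n tn] u [m um]].
- by exists n.+1 => /=.
- by exists 0.
- by exists n.
- exists (maxn n m) => /=.
  by rewrite (term_ltW _ _ _ (leq_maxl n m)) // (term_ltW _ _ _ (leq_maxr n m)).
- exists (maxn n m) => /=.
  by rewrite (term_ltW _ _ _ (leq_maxl n m)) // (term_ltW _ _ _ (leq_maxr n m)).
Qed.

Lemma form_bounded f : exists n, form_lt n f.
Proof.
elim: f => [t u||f [n fn] g [m gm]|f [n fn]].
- have [[n tn] [m um]] := (term_bounded t, term_bounded u).
  exists (maxn n m) => /=.
  by rewrite (term_ltW _ _ _ (leq_maxl n m)) // (term_ltW _ _ _ (leq_maxr n m)).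
- by exists 0.
- exists (maxn n m) => /=.
  by rewrite (form_ltW _ _ _ (leq_maxl n m)) // (form_ltW _ _ _ (leq_maxr n m)).
- by exists n => /=; apply: form_ltW fn.
Qed.

(** * Soundness *)

Lemma eq_scons (X : Type) (x : X) s s' : s =1 s' -> scons x s =1 scons x s'.
Proof. by move=> ss' [|n] /=. Qed.

Lemma eq_teval r r' t : r =1 r' -> teval r t = teval r' t.
Proof. by move=> rr'; elim: t => //= [t ->|t -> u ->|t -> u ->]. Qed.

Lemma eq_sat r r' f : r =1 r' -> sat r f <-> sat r' f.
Proof.
elim: f r r' => [t u||f IHf g IHg|f IHf] r r' rr' //=.
- by rewrite !(eq_teval _ _ _ rr').
- by have [/= ? ?] := (IHf _ _ rr', IHg _ _ rr'); tauto.
- by split=> sf n; have := sf n; rewrite (IHf _ _ (eq_scons _ n _ _ rr')).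
Qed.

Lemma teval_subst r s t :
  teval r (subst_term s t) = teval (fun n => teval r (s n)) t.
Proof. by elim: t => //= [t ->|t -> u ->|t -> u ->]. Qed.

Lemma sat_subst r s f :
  sat r (subst s f) <-> sat (fun n => teval r (s n)) f.
Proof.
elim: f r s => [t u||f IHf g IHg|f IHf] r s //=.
- by rewrite !teval_subst.
- by have [/= ? ?] := (IHf r s, IHg r s); tauto.
- have up_s n : (fun i => teval (scons n r) (up s i))
                =1 scons n (fun i => teval r (s i)).
    by case=> //= i; rewrite /shift_term teval_subst; apply: eq_teval.
  by split=> sf n; have := sf n;
    rewrite (IHf (scons n r) (up s)) (eq_sat _ _ f (up_s n)).
Qed.

Lemma sat_shift r n f : sat (scons n r) (shift f) <-> sat r f.
Proof. by rewrite /shift sat_subst; apply: eq_sat. Qed.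

Lemma sat_inst r t f : sat r (inst t f) <-> sat (scons (teval r t) r) f.
Proof. by rewrite /inst sat_subst; apply: eq_sat => -[]. Qed.

Lemma teval_num r n : teval r (num n) = n.
Proof. by elim: n => //= n ->. Qed.

Lemma In_map (X Y : Type) (h : X -> Y) (l : seq X) y :
  List.In y (map h l) <-> exists2 x, List.In x l & y = h x.
Proof.
split; last by case=> x + ->; elim: l => //= z l IHl [->|/IHl]; [left|right].
elim: l => //= x l IHl [<-|/IHl[z lz ->]]; first by exists x; [left|].
by exists z; [right|].
Qed.

Lemma prv_sound T G f r :
  (forall g, T g -> holds g) -> prv T G f ->
  (forall g, List.In g G -> sat r g) -> sat r f.
Proof.
move=> soundT prvf; elim: prvf r => {G f}.
- by move=> G f /soundT Tf r _.
- by move=> G f Gf r; apply.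
- by move=> G f g _ IH r satG /= sf; apply: IH => h [<-|/satG].
- by move=> G f g _ IHf _ IHg r satG; apply: (IHf r satG); apply: IHg.
- by move=> G f _ IH r satG; apply: NNPP; apply: (IH r satG).
- move=> G f _ IH r satG n; apply: IH => g /In_map[h Gh ->].
  by apply/sat_shift/satG.
- by move=> G f t _ IH r satG; apply/sat_inst/(IH r satG).
- by [].
- move=> G f t u _ IHtu _ IHf r satG; apply/sat_inst.
  by rewrite -(IHtu r satG : teval r t = teval r u); apply/sat_inst/IHf.
Qed.

Lemma PA_true f : PA f -> holds f.
Proof.
case=> [|||||| {}f] r //=.
- by case.
- by rewrite addn0.
- by rewrite addnS.
- by rewrite muln0.
- by rewrite mulnS addnC.
- move=> /sat_inst f0 IH; elim=> // n IHn.
  have /sat_subst := IH n IHn.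
  by rewrite (eq_sat _ (scons n.+1 r)) // => -[].
Qed.

Lemma PA_sound f : proves PA f -> holds f.
Proof. by move=> prvf r; apply: prv_sound PA_true prvf _ => g []. Qed.

(** * Natural deduction *)

Lemma prv_weaken T T' G G' f :
  (forall g, T g -> T' g) -> List.incl G G' -> prv T G f -> prv T' G' f.
Proof.
move=> TT' GG' prvf; elim: prvf G' GG' => {G f}.
- by move=> G f /TT' T'f G' _; apply: prv_ax.
- by move=> G f Gf G' GG'; apply/prv_hyp/GG'.
- move=> G f g _ IH G' GG'; apply/prv_impI/IH => h [<-|/GG'].
    by left.
  by right.
- by move=> G f g _ IHf _ IHg G' GG'; apply: prv_impE (IHf _ GG') (IHg _ GG').
- by move=> G f _ IH G' GG'; apply/prv_dne/IH.
- move=> G f _ IH G' GG'; apply/prv_allI/IH => g /In_map[h /GG' G'h ->].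
  by apply/In_map; exists h.
- by move=> G f t _ IH G' GG'; apply/prv_allE/IH.
- by move=> G t G' _; apply: prv_eq_refl.
- by move=> G f t u _ IHtu _ IHf G' GG';
    apply: prv_eq_subst (IHtu _ GG') (IHf _ GG').
Qed.

Section NaturalDeduction.

Variable T : form -> Prop.
Implicit Types (G : seq form) (f g h : form) (t u v : term).

Lemma prvW G f : proves T f -> prv T G f.
Proof. by apply: prv_weaken => // g []. Qed.

Lemma prv_mp G f g : proves T (fimp f g) -> prv T G f -> prv T G g.
Proof. by move/(prvW G); apply: prv_impE. Qed.

Lemma prv_exfalso G f : prv T G fbot -> prv T G f.
Proof.
move=> bot; apply/prv_dne/prv_impI.
by apply: prv_weaken bot => // g Gg; right.
Qed.

Lemma prv_all_impE G t f g :
  prv T G (fall (fimp f g)) -> prv T G (inst t f) -> prv T G (inst t g).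
Proof. by move=> /(prv_allE t); apply: prv_impE. Qed.

Lemma proves_const f g : proves T g -> proves T (fimp f g).
Proof. by move=> Tg; apply/prv_impI/prvW. Qed.

Lemma proves_trans f g h :
  proves T (fimp f g) -> proves T (fimp g h) -> proves T (fimp f h).
Proof.
move=> fg gh; apply/prv_impI/(prv_mp _ _ _ gh)/(prv_mp _ _ _ fg).
by apply: prv_hyp; left.
Qed.

Lemma proves_iffE f g :
  proves T (fiff f g) -> proves T (fimp f g) /\ proves T (fimp g f).
Proof.
(* A conjunction is a negated implication, so each half is obtained by refuting its negation. *)
move=> fg; split; apply/prv_dne/prv_impI; apply: prv_mp fg _;
  apply: prv_impI.
- apply: prv_exfalso; apply: (@prv_impE _ _ (fimp f g)).
    by apply: prv_hyp; right; left.
  by apply: prv_hyp; left.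
- by apply: prv_hyp; right; left.
Qed.

Lemma prv_exI G t f : prv T G (inst t f) -> prv T G (fex f).
Proof.
move=> ft; apply: prv_impI; apply: (@prv_impE _ _ (inst t f)).
  by apply: (@prv_allE _ _ (fneg f)); apply: prv_hyp; left.
by apply: prv_weaken ft => // g Gg; right.
Qed.

Lemma proves_exE f g :
  proves T (fimp f (shift g)) -> proves T (fimp (fex f) g).
Proof.
move=> fg; apply/prv_impI/prv_dne/prv_impI.
apply: (@prv_impE _ _ (fall (fneg f))); first by apply: prv_hyp; right; left.
(* Generalization shifts the hypothesis [fneg g], so the witness variable does not occur in it. *)
apply/prv_allI/prv_impI; apply: (@prv_impE _ _ (shift g)).
  by apply: prv_hyp; right; left.
by apply: (prv_mp _ _ _ fg); apply: prv_hyp; left.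
Qed.

(** The [n] quantifiers are eliminated one at a time, at the terms that [s'] assigns to the indices
    below [n]; the remaining values of [s'] are those of [s]. *)
Lemma proves_inst_all n s s' f :
  (forall i, s' (n + i) = s i) ->
  proves T (subst s (iter n fall f)) -> proves T (subst s' f).
Proof.
elim: n f s' => [|n IHn] f s' ss'; first by rewrite (eq_subst s' s).
rewrite iterSr => /(IHn _ (fun i => s' i.+1) ss') /prv_allE-/(_ (s' 0)).
by rewrite inst_subst (eq_subst _ s') // => -[].
Qed.

Lemma form_lt_iter_all n m f :
  form_lt (n + m) f -> form_lt m (iter n fall f).
Proof. by elim: n m => // n IHn m; rewrite addSnnS => /IHn. Qed.

(** The calculus has no substitution rule. With no local hypotheses, [f] can be closed by
    quantifiers; its closure is unaffected by substitution and is then instantiated at the terms of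
    [s]. *)
Lemma proves_subst s f : proves T f -> proves T (subst s f).
Proof.
move=> Tf; have [n fn] := form_bounded f.
apply: (@proves_inst_all n (fun i => s (n + i))) => //.
rewrite (@subst_lt 0 _ tvar) // ?subst_tvar.
  by elim: n {fn} => // n IHn; apply: prv_allI.
by apply: form_lt_iter_all; rewrite addn0.
Qed.

Lemma inst_shift_term t u : subst_term (scons t tvar) (shift_term u) = u.
Proof. by rewrite /shift_term subst_term_comp subst_term_tvar. Qed.

Lemma prv_eq_sym G t u : prv T G (feq t u) -> prv T G (feq u t).
Proof.
move=> tu.
(* Leibniz's law is applied to a template in which variable 0 marks the place to be replaced;
   shifting protects the other terms. The congruence lemmas below use the same device. *)
have := @prv_eq_subst T G (feq (tvar 0) (shift_term t)) t u tu.
by rewrite /inst /= !inst_shift_term; apply; apply: prv_eq_refl.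
Qed.

Lemma prv_eq_trans G u t v :
  prv T G (feq t u) -> prv T G (feq u v) -> prv T G (feq t v).
Proof.
move=> tu uv.
have := @prv_eq_subst T G (feq (shift_term t) (tvar 0)) u v uv.
by rewrite /inst /= !inst_shift_term; apply.
Qed.

Lemma prv_eq_succ G t u :
  prv T G (feq t u) -> prv T G (feq (tsucc t) (tsucc u)).
Proof.
move=> tu.
have := @prv_eq_subst T G (feq (tsucc (shift_term t)) (tsucc (tvar 0))) t u tu.
by rewrite /inst /= !inst_shift_term; apply; apply: prv_eq_refl.
Qed.

Lemma prv_eq_add G t t' u u' :
  prv T G (feq t t') -> prv T G (feq u u') ->
  prv T G (feq (tadd t u) (tadd t' u')).
Proof.
move=> tt' uu'; apply: (@prv_eq_trans _ (tadd t' u)).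
  have := @prv_eq_subst T G
    (feq (shift_term (tadd t u)) (tadd (tvar 0) (shift_term u))) t t' tt'.
  by rewrite /inst /= !inst_shift_term; apply; apply: prv_eq_refl.
have := @prv_eq_subst T G
  (feq (shift_term (tadd t' u)) (tadd (shift_term t') (tvar 0))) u u' uu'.
by rewrite /inst /= !inst_shift_term; apply; apply: prv_eq_refl.
Qed.

Lemma prv_eq_mul G t t' u u' :
  prv T G (feq t t') -> prv T G (feq u u') ->
  prv T G (feq (tmul t u) (tmul t' u')).
Proof.
move=> tt' uu'; apply: (@prv_eq_trans _ (tmul t' u)).
  have := @prv_eq_subst T G
    (feq (shift_term (tmul t u)) (tmul (tvar 0) (shift_term u))) t t' tt'.
  by rewrite /inst /= !inst_shift_term; apply; apply: prv_eq_refl.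
have := @prv_eq_subst T G
  (feq (shift_term (tmul t' u)) (tmul (shift_term t') (tvar 0))) u u' uu'.
by rewrite /inst /= !inst_shift_term; apply; apply: prv_eq_refl.
Qed.

End NaturalDeduction.

(** * Sigma_1-completeness *)

Lemma PA_inst s f : PA f -> proves PA (subst s f).
Proof. by move=> PAf; apply/proves_subst/prv_ax. Qed.

Definition subst2 (t u : term) : nat -> term := scons t (scons u tvar).

Lemma PA_eq_addS t u :
  proves PA (feq (tadd t (tsucc u)) (tsucc (tadd t u))).
Proof. exact: PA_inst (subst2 t u) _ PA_addS. Qed.

Lemma PA_succ_inj_terms t u :
  proves PA (fimp (feq (tsucc t) (tsucc u)) (feq t u)).
Proof. exact: PA_inst (subst2 t u) _ PA_succ_inj. Qed.

Lemma PA_succ_neq_zero t : proves PA (fneg (feq (tsucc t) tzero)).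
Proof. exact: PA_inst (subst2 t t) _ PA_succ_neq0. Qed.

Lemma PA_num_add m n : proves PA (feq (tadd (num m) (num n)) (num (m + n))).
Proof.
elim: n => [|n IHn] /=.
  by rewrite addn0; apply: PA_inst (subst2 (num m) tzero) _ PA_add0.
rewrite addnS; apply: prv_eq_trans (PA_eq_addS _ _) _.
exact: prv_eq_succ.
Qed.

Lemma PA_num_mul m n : proves PA (feq (tmul (num m) (num n)) (num (m * n))).
Proof.
elim: n => [|n IHn] /=.
  by rewrite muln0; apply: PA_inst (subst2 (num m) tzero) _ PA_mul0.
have := PA_inst (subst2 (num m) (num n)) _ PA_mulS => /= mulS.
rewrite mulnS addnC; apply: prv_eq_trans mulS _.
apply: prv_eq_trans (PA_num_add _ _).
by apply: prv_eq_add => //; apply: prv_eq_refl.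
Qed.

(** A valuation enters the syntax as a substitution of numerals; the completeness results below have
    the same form. *)
Lemma PA_teval r t :
  proves PA (feq (subst_term (fun i => num (r i)) t) (num (teval r t))).
Proof.
elim: t => [n||t IHt|t IHt u IHu|t IHt u IHu] /=; try exact: prv_eq_refl.
- exact: prv_eq_succ.
- by apply: prv_eq_trans (PA_num_add _ _); apply: prv_eq_add.
- by apply: prv_eq_trans (PA_num_mul _ _); apply: prv_eq_mul.
Qed.

Lemma PA_num_neq m n : m <> n -> proves PA (fneg (feq (num m) (num n))).
Proof.
elim: m n => [|m IHm] [|n] //= neq_mn.
- apply: prv_impI; apply: prv_mp (PA_succ_neq_zero (num n)) _.
  by apply: prv_eq_sym; apply: prv_hyp; left.
- exact: PA_succ_neq_zero.
- apply: proves_trans (PA_succ_inj_terms _ _) (IHm _ _) => eq_mn.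
  by case: neq_mn; rewrite eq_mn.
Qed.

(** This is induction on variable 0 with the induction hypothesis discarded. *)
Lemma PA_cases f :
  proves PA (inst tzero f) ->
  proves PA (subst (scons (tsucc (tvar 0)) (fun n => tvar n.+1)) f) ->
  proves PA f.
Proof.
(* Eliminating [fall f] directly at [tvar 0] would lower the other variables of [f], so the
   closed-off formula is shifted first. *)
move=> f0 fS; rewrite -(subst_tvar f).
have := @prv_allE PA [::] (subst (up (fun n => tvar n.+1)) f) (tvar 0).
rewrite inst_subst (eq_subst (scons _ _) tvar); last by case.
apply; apply: (proves_subst _ (fun n => tvar n.+1) (fall f)).
apply: prv_impE (prv_impE (prv_ax _ (PA_induction f)) f0) _.
by apply/prv_allI/proves_const.
Qed.

(* Variable 1 is the witness of the inequality [flt (tvar 0) (num n)]. *)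
Lemma PA_below_num n f :
  (forall i, i < n -> proves PA (inst (num i) f)) ->
  proves PA (fimp (feq (tadd (tvar 1) (tsucc (tvar 0))) (num n)) f).
Proof.
elim: n f => [|n IHn] f fn.
  apply/prv_impI/prv_exfalso.
  apply: prv_mp (PA_succ_neq_zero (tadd (tvar 1) (tvar 0))) _.
  apply: prv_eq_trans; last by apply: prv_hyp; left.
  exact/prv_eq_sym/prvW/PA_eq_addS.
(* Variable 0 is either zero, where [f] is given, or a successor. In the latter case the bound drops
   to [n] and the induction hypothesis applies to [f] at the successor. *)
apply: PA_cases; first by apply: proves_const; apply: (fn 0).
pose g := subst (scons (tsucc (tvar 0)) (fun n => tvar n.+1)) f.
rewrite -/g /= subst_term_num.
have {}/IHn gn : forall i, i < n -> proves PA (inst (num i) g).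
  move=> i lt_in; rewrite /g /inst subst_comp.
  rewrite (eq_subst _ (scons (num i.+1) tvar)).
    exact: fn.
  by case.
apply/prv_impI/(prv_mp _ _ _ _ gn)/(prv_mp _ _ _ _ (PA_succ_inj_terms _ _)).
apply: prv_eq_trans; last by apply: prv_hyp; left.
exact/prv_eq_sym/prvW/PA_eq_addS.
Qed.

Lemma PA_bounded_all t n f :
  proves PA (feq t (num n)) ->
  (forall i, i < n -> proves PA (inst (num i) f)) ->
  proves PA (fall (fimp (flt (tvar 0) (shift_term t)) f)).
Proof.
move=> tn fn; apply/prv_allI/proves_exE.
(* Renaming frees variable 1 in [f] for the witness of the inequality. *)
pose f' := subst (up (fun i => tvar i.+1)) f.
have /PA_below_num : forall i, i < n -> proves PA (inst (num i) f').
  move=> i /fn/(proves_subst _ (fun i => tvar i.+1)).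
  rewrite /f' inst_subst /inst subst_comp.
  by rewrite (eq_subst _ (scons (num i) (fun i => tvar i.+1))) // => -[|j] //=;
    rewrite ?subst_term_num.
(* After [proves_exE] the witness is variable 0 and the bounded variable is variable 1, the reverse
   of the order in [PA_below_num]. *)
pose swap := scons (tvar 1) (scons (tvar 0) (fun i => tvar i.+2)).
move/(proves_subst _ swap) => /=; rewrite subst_term_num /f' subst_comp.
rewrite (eq_subst _ (fun i => tvar i.+1)); last by case.
move=> below; apply/prv_impI/(prv_mp _ _ _ _ below).
apply: prv_eq_trans; first by apply: prv_hyp; left.
apply: prvW; rewrite /shift_term subst_term_comp /=.
by have := proves_subst _ (fun i => tvar i.+2) _ tn; rewrite /= subst_term_num.
Qed.

Lemma subst_flt s t u :
  subst s (flt t u) = flt (subst_term s t) (subst_term s u).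
Proof. by rewrite /flt /= !subst_term_up. Qed.

Lemma sat_flt r t u : sat r (flt t u) <-> teval r t < teval r u.
Proof.
rewrite /flt /=; have shiftE n v : teval (scons n r) (shift_term v) = teval r v.
  by rewrite /shift_term teval_subst; apply: eq_teval.
split=> [|lt_tu].
  move=> ex; apply: NNPP => nlt; apply: ex => n; rewrite !shiftE => eq_u.
  by apply: nlt; rewrite -eq_u addnS ltnS leq_addl.
move/(_ (teval r u - (teval r t).+1)); rewrite !shiftE; apply.
by rewrite subnK.
Qed.

Lemma PA_num_lt m n t :
  m < n -> proves PA (feq t (num n)) -> proves PA (flt (num m) t).
Proof.
(* The witness solves [z + m.+1 = n]. *)
move=> lt_mn tn; apply: (@prv_exI _ _ (num (n - m.+1))).
rewrite /inst /= !inst_shift_term.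
apply: prv_eq_trans (PA_num_add _ m.+1) _; rewrite subnK //.
exact: prv_eq_sym.
Qed.

Lemma inst_num r n f :
  inst (num n) (subst (up (fun i => num (r i))) f) =
  subst (fun i => num (scons n r i)) f.
Proof. by rewrite inst_subst; apply: eq_subst => -[]. Qed.

(** Truth and falsity are handled together because a true implication may rest on a false premise. A
    bounded quantifier reduces to finitely many numerals, since PA evaluates its bound. *)
Lemma delta0_complete f r : delta0 f ->
  (sat r f -> proves PA (subst (fun i => num (r i)) f)) /\
  (~ sat r f -> proves PA (fneg (subst (fun i => num (r i)) f))).
Proof.
move=> d0f; elim: d0f r => {f} [t u||f g _ IHf _ IHg|t f _ IHf] r.
- have [tE uE] := (PA_teval r t, PA_teval r u); split=> /=.
    move=> eq_tu; apply: prv_eq_trans tE _; rewrite eq_tu.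
    exact: prv_eq_sym.
  move/PA_num_neq=> neq_tu; apply/prv_impI/(prv_mp _ _ _ _ neq_tu).
  apply: prv_eq_trans (prv_eq_sym _ _ _ _ (prvW _ _ _ tE)) _.
  apply: prv_eq_trans (prvW _ _ _ uE); apply: prv_hyp; by left.
- by split=> //= _; apply: prv_impI; apply: prv_hyp; left.
- have [[f1 f0] [g1 g0]] := (IHf r, IHg r); split=> /= sfg.
    have [/sfg/g1|/f0 nf] := classic (sat r f); first exact: proves_const.
    by apply/prv_impI/prv_exfalso/(prv_mp _ _ _ _ nf)/prv_hyp; left.
  have [/f1 Pf /g0 Ng] : sat r f /\ ~ sat r g by apply: imply_to_and.
  apply/prv_impI/(prv_mp _ _ _ _ Ng); apply: prv_impE (prvW _ _ _ Pf).
  by apply: prv_hyp; left.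
- set s := fun i => num (r i).
  have -> : subst s (fall (fimp (flt (tvar 0) (shift_term t)) f)) =
      fall (fimp (flt (tvar 0) (shift_term (subst_term s t))) (subst (up s) f)).
    by rewrite -[LHS]/(fall (fimp (subst (up s) (flt _ _)) _)) subst_flt
      subst_term_up.
  have ltE m : sat (scons m r) (flt (tvar 0) (shift_term t)) <-> m < teval r t.
    rewrite sat_flt /= /shift_term teval_subst.
    by rewrite (eq_teval _ r).
  have tE := PA_teval r t; split=> [sf|].
    apply: PA_bounded_all tE _ => i /ltE/(sf i) /=.
    by rewrite inst_num; apply: (IHf _).1.
  move=> nall; have [m nm] := not_all_ex_not _ _ nall.
  have [/ltE lt_mt nsf] := imply_to_and _ _ nm.
  (* The counterexample [m] lies below the bound provably, so the universal formula yields the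
     instance that the induction hypothesis refutes. *)
  apply/prv_impI/(prv_mp _ _ _ _ ((IHf _).2 nsf)).
  rewrite -inst_num.
  pose bound := flt (tvar 0) (shift_term (subst_term s t)).
  apply: (@prv_all_impE _ _ (num m) bound).
    by apply: prv_hyp; left.
  rewrite /inst subst_flt inst_shift_term.
  exact: prvW (PA_num_lt _ _ _ lt_mt tE).
Qed.

Lemma sigma1_complete f r :
  sigma1 f -> sat r f -> proves PA (subst (fun i => num (r i)) f).
Proof.
move=> s1f; elim: s1f r => {f} [f d0f|f _ IHf] r.
  exact: (delta0_complete _ _ d0f).1.
move=> sf; have [n] : exists n, sat (scons n r) f.
  by apply: NNPP => nex; apply: sf => n sn; apply: nex; exists n.
by move/IHf; rewrite -inst_num; apply: prv_exI.
Qed.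

Lemma pi1_refutable f r :
  pi1 f -> ~ sat r f -> proves PA (fneg (subst (fun i => num (r i)) f)).
Proof.
move=> p1f; elim: p1f r => {f} [f d0f|f _ IHf] r.
  exact: (delta0_complete _ _ d0f).2.
case/not_all_ex_not=> n /IHf; rewrite -inst_num => nf.
apply/prv_impI/(prv_mp _ _ _ _ nf)/prv_allE.
by apply: prv_hyp; left.
Qed.

(** * Reflection principles *)

(** This brings instances of the proof predicate into the form required by the completeness
    results. *)
Lemma apply2_num Prf m n :
  apply2 Prf (num m) (num n) =
  subst (fun i => num (scons m (fun=> n) i)) Prf.
Proof. by apply: eq_subst => -[]. Qed.

Lemma sentence_apply2 f s t : form_lt 2 f -> term_lt 0 s -> term_lt 0 t ->
  sentence (apply2 f s t).
Proof. by move=> f2 s0 t0; apply: form_lt_subst f2 _ => -[]. Qed.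

Lemma sat_apply2_num Prf r m n :
  sat r (apply2 Prf (num m) (num n)) <-> sat (scons m (fun=> n)) Prf.
Proof.
rewrite apply2_num sat_subst; apply: eq_sat => i.
exact: teval_num.
Qed.

Section ReflectionPrinciples.

Variable Prf : form.
Hypothesis Prf_proof : proof_predicate Prf.
Hypothesis Prf_logic : provability_logic Prf.

Let Prf2 : form_lt 2 Prf. Proof. by case: Prf_proof. Qed.

(** The Sigma_1 form of [Prf] proves true instances and the Pi_1 form refutes false ones. Soundness
    of PA carries truth values between [Prf] and these two forms. *)
Lemma proof_of_decides k f :
  (holds (proof_of Prf k f) /\ proves PA (proof_of Prf k f)) \/
  proves PA (fneg (proof_of Prf k f)).
Proof.
have [_ [[g s1g gE] [h p1h hE]] _] := Prf_proof.
have [[Pg gP] [Ph hP]] := (proves_iffE _ _ _ gE, proves_iffE _ _ _ hE).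
rewrite /proof_of; set r := scons k (fun=> code f).
have [sP|nP] := classic (sat r Prf); [left; split|right].
- by move=> r'; apply/sat_apply2_num.
- rewrite apply2_num -/r.
  apply: prv_impE (proves_subst _ (fun i => num (r i)) _ gP) _.
  exact/(sigma1_complete _ _ s1g)/(PA_sound _ Pg).
- rewrite apply2_num -/r.
  apply: proves_trans (proves_subst _ (fun i => num (r i)) _ Ph) _.
  by apply: pi1_refutable => // /(PA_sound _ hP).
Qed.

Lemma sentence_provable f : sentence (provable Prf f).
Proof.
rewrite /sentence /= !andbT.
by apply: form_lt_subst Prf2 _ => -[|i] //= _; apply: term_lt_num.
Qed.

Lemma sentence_proof_of k f : sentence (proof_of Prf k f).
Proof. by apply: sentence_apply2 Prf2 _ _; apply: term_lt_num. Qed.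

Lemma sentence_iter_provable k f :
  sentence f -> sentence (iter k (provable Prf) f).
Proof. by case: k => //= k _; apply: sentence_provable. Qed.

Lemma sentence_interp i F : sentence (interp Prf i F).
Proof.
elim: F => [p||F IHF G IHG|F _|u F _] //=.
- exact: letter_sentence.
- by apply/andP.
- exact: sentence_provable.
- exact: sentence_proof_of.
Qed.

(** A theorem has a proof numbered by some standard [k]. The corresponding instance cannot be
    refutable, since PA is sound, so PA proves it and [num k] witnesses the existential. *)
Lemma provable_nec f :
  sentence f -> proves PA f -> proves PA (provable Prf f).
Proof.
have [_ _ PrfE] := Prf_proof; move=> sf /(PrfE _ sf)[k hk].
have [[_ Pk]|/PA_sound nk] := proof_of_decides k f; last first.
  by case: (nk (fun=> 0) (hk _)).
apply: (prv_exI _ _ (num k)); rewrite /inst /apply2 subst_comp.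
move: Pk; rewrite /proof_of /apply2; congr proves; apply: eq_subst => -[|i] //=.
by rewrite subst_term_num.
Qed.

(** Satisfaction refers to the standard model, so the witness of the existential is the number of an
    actual proof. *)
Lemma provable_true f r :
  sentence f -> sat r (provable Prf f) -> proves PA f.
Proof.
have [_ _ PrfE] := Prf_proof; move=> sf ex; apply/(PrfE _ sf).
apply: NNPP => nex; apply: ex => k sk; apply: nex; exists k => r'.
apply/sat_apply2_num; move/sat_subst: sk.
by apply: (eq_sat _ _ _ _).1 => -[|i] //=; rewrite teval_num.
Qed.

(** Each further box takes one necessitation and one use of the distribution axiom. *)
Lemma iter_provable_mono k f g : sentence f -> sentence g ->
  proves PA (fimp f g) ->
  proves PA (fimp (iter k (provable Prf) f) (iter k (provable Prf) g)).
Proof.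
move=> sf sg fg; elim: k => //= k IHk; have [K _ _] := Prf_logic.
have sf' := sentence_iter_provable k _ sf.
have sg' := sentence_iter_provable k _ sg.
apply: prv_impE (K _ _ sf' sg') _; apply: provable_nec => //.
by rewrite /sentence /=; apply/andP.
Qed.

Lemma interp_iter_Box i k F :
  interp Prf i (iter k Box F) = iter k (provable Prf) (interp Prf i F).
Proof. by elim: k => //= k ->. Qed.

(** By soundness of PA the modal formula is true, and for either modality its truth supplies an
    actual proof of [F]. *)
Lemma modal_sound i Q F :
  proves PA (interp Prf i (modal Q F)) -> proves PA (interp Prf i F).
Proof.
have sF := sentence_interp i F; have [_ _ PrfE] := Prf_proof.
case: Q => [|u] /PA_sound hF.
  exact: provable_true sF (hF (fun=> 0)).
by apply/(PrfE _ sF); exists (pvar i u).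
Qed.

Lemma modalities_sound i Qs F :
  proves PA (interp Prf i (foldr modal F Qs)) -> proves PA (interp Prf i F).
Proof. by elim: Qs => //= Q Qs IHQs /modal_sound. Qed.

Lemma proves_PA_or S f : proves PA f -> proves (fun g => PA g \/ S g) f.
Proof. by apply: prv_weaken => // g; left. Qed.

(** The general shape of a generator with an explicit proof: [Qs] is whatever follows the first one.
    Empty [Qs] gives the canonical representative. *)
Definition boxed_proof k u Qs P : mform :=
  Imp (iter k Box (Pr u (foldr modal (Letter P) Qs))) (Letter P).

Lemma boxed_proof_consistency S k u Qs P :
  (forall f, interps Prf (boxed_proof k u Qs P) f -> S f) ->
  proves (fun g => PA g \/ S g) (fneg (iter k (provable Prf) fbot)).
Proof.
(* Reading [P] as falsity turns the generator into a negation. The number 0 for proof variables is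
   arbitrary: falsity implies the innermost formula anyway, and monotonicity carries this under the
   boxes. *)
move=> Sgen; pose i := @Interpretation (fun=> fbot) (fun=> isT) (fun=> 0).
set F := Pr u (foldr modal (Letter P) Qs).
apply: (proves_trans _ _ (interp Prf i (iter k Box F))).
  rewrite interp_iter_Box; apply: proves_PA_or; apply: iter_provable_mono => //.
    exact: sentence_interp.
  by apply/prv_impI/prv_exfalso/prv_hyp; left.
by apply: prv_ax; right; apply: Sgen; exists i.
Qed.

Lemma consistency_boxed_proof T k u Qs P f :
  (forall g, PA g -> T g) ->
  proves T (fneg (iter k (provable Prf) fbot)) ->
  interps Prf (boxed_proof k u Qs P) f -> proves T f.
Proof.
move=> PAT con [i ->] /=; set F := foldr _ _ _.
have PAT' := prv_weaken _ T _ _ _ PAT (List.incl_refl [::]).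
(* If the explicit proof is correct, stripping the modalities of [Qs] makes the interpreted letter a
   theorem of PA. Otherwise the boxed formula implies iterated boxes over falsity, contradicting
   [con]. *)
have [[hF _]|nF] := proof_of_decides (pvar i u) (interp Prf i F).
  have [_ _ PrfE] := Prf_proof.
  apply/PAT'/proves_const/(modalities_sound i Qs (Letter P)).
  by apply/(PrfE _ (sentence_interp i F)); exists (pvar i u).
rewrite interp_iter_Box; apply: (proves_trans _ _ (iter k (provable Prf) fbot)).
  by apply/PAT'/iter_provable_mono => //; apply: sentence_interp.
apply/prv_impI/prv_exfalso/(prv_mp _ _ _ _ con).
by apply: prv_hyp; left.
Qed.

(** Both sides are compared through the consistency statement for [k], which mentions neither proof
    variables nor the remaining modalities. *)
Lemma boxed_proof_reducible k u v Qs Qs' P :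
  reducible Prf (boxed_proof k u Qs P) (boxed_proof k v Qs' P).
Proof.
move=> f; apply: consistency_boxed_proof; first by left.
exact: (boxed_proof_consistency (interps Prf _) k v Qs' P (fun _ => id)).
Qed.

Lemma interps_reflection f P : sentence f ->
  interps Prf (Imp (Box (Letter P)) (Letter P)) (fimp (provable Prf f) f).
Proof.
by move=> sf; exists (@Interpretation (fun=> f) (fun=> sf) (fun=> 0)).
Qed.

Lemma iter_Box_reducible k P :
  reducible Prf (Imp (iter k Box (Letter P)) (Letter P))
                (Imp (Box (Letter P)) (Letter P)).
Proof.
move=> f [i ->] /=; rewrite interp_iter_Box /=.
have sP := letter_sentence i P; elim: k => [|k IHk] /=.
  by apply/prv_impI/prv_hyp; left.
(* The outermost box is removed by the instance of reflection in which the letter stands for the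
   sentence under that box. *)
apply: proves_trans IHk; apply: prv_ax; right.
exact/interps_reflection/sentence_iter_provable.
Qed.

(** At least one box is required: without boxes the generator would be a tautology. Extra boxes are
    added to the premise by transitivity of provability. *)
Lemma reducible_iter_Box k P :
  reducible Prf (Imp (Box (Letter P)) (Letter P))
                (Imp (iter k.+1 Box (Letter P)) (Letter P)).
Proof.
move=> f [i ->]; have [_ four _] := Prf_logic; have sP := letter_sentence i P.
apply: (proves_trans _ _ (interp Prf i (iter k.+1 Box (Letter P)))).
  rewrite interp_iter_Box; apply: proves_PA_or.
  elim: k => [|k IHk] /=; first by apply/prv_impI/prv_hyp; left.
  apply: proves_trans IHk _; apply: four; exact: sentence_iter_provable.
by apply: prv_ax; right; exists i.
Qed.

(** The prefix is split at its first explicit proof, if there is one; [k] counts the boxes before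
    it. *)
Lemma modalities_cases Qs F :
  foldr modal F Qs = iter (size Qs) Box F \/
  exists k u Qs', foldr modal F Qs = iter k Box (Pr u (foldr modal F Qs')).
Proof.
elim: Qs => [|[|u] Qs IHQs]; first by left.
- case: IHQs => [/= ->|[k [u [Qs' /= ->]]]]; first by left.
  by right; exists k.+1, u, Qs'.
- by right; exists 0, u, Qs.
Qed.

End ReflectionPrinciples.

Theorem theorem4 (Prf : form)
    (hProof : proof_predicate Prf)
    (hNormal : normal Prf)
    (hPL : provability_logic Prf)
    (P : nat) (Qs : seq modality)
    (hQs : 0 < size Qs)
    (hFresh : uniq (proof_vars Qs)) :
  equivalent Prf (generator Qs P) (Imp (Box (Letter P)) (Letter P)) \/
  exists k : nat, forall u : nat,
    equivalent Prf (generator Qs P)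
      (Imp (iter k Box (Pr u (Letter P))) (Letter P)).
Proof.
rewrite /generator.
have [->|[k [v [Qs' ->]]]] := modalities_cases Qs (Letter P).
  left; split; first exact: iter_Box_reducible.
  by case: (size Qs) hQs => // m _; apply: reducible_iter_Box.
(* The target is [boxed_proof] with an empty tail, so both directions are instances of the same
   reducibility. *)
right; exists k => u; split.
  exact: (boxed_proof_reducible _ hProof hPL k v u Qs' [::]).
exact: (boxed_proof_reducible _ hProof hPL k u v [::] Qs').
Qed.
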